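(* Let $m\leq n$ be positive integers. If $f\in\mathcal{W}_{n}$ and $g\in\mathcal{V}_{m}$, then $f\bullet g\subset\mathcal{V}_{m}$.
   Context: For an integer $k\ge 0$, $\mathbb{R}_k^+$ denotes the set of real polynomials $s\mapsto c_0+c_1s+\ldots+c_ks^k$ with all $c_i>0$ ($i=0,\ldots,k$). For $k\ge 1$, $\mathcal{H}_k$ is the set of $f\in\mathbb{R}_k^+$ all of whose complex zeros have negative real part (Hurwitz stable polynomials). For $k\ge 3$ and $f(s)=a_0+a_1s+\ldots+a_ks^k\in\mathbb{R}_k^+$ put $\lambda_i(f)=\dfrac{a_{i-2}a_{i+1}}{a_ia_{i-1}}$ for $i=2,\ldots,k-1$. For $k\ge 3$ let $\mathcal{W}_k=\{f\in\mathbb{R}_k^+:\lambda_i(f)<1\ (i=2,\ldots,k-1)\}$ and $\mathcal{V}_k=\{f\in\mathbb{R}_k^+:\lambda_2(f)+\ldots+\lambda_{k-1}(f)<1\}$. By definition $\mathcal{W}_k=\mathcal{V}_k=\mathcal{H}_k$ for $k=1,2$. For $f(s)=\sum_{i=0}^n a_is^i\in\mathbb{R}_n^+$ and $g(s)=\sum_{i=0}^m b_is^i\in\mathbb{R}_m^+$ with $m\le n$, the generalized Hadamard product of $f$ and $g$ is the set $f\bullet g=\{F_0,\ldots,F_{n-m}\}$, where $F_j(s)=\sum_{i=0}^m a_{j+i}b_is^i$ for $j=0,\ldots,n-m$. *)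

(* Defs.v *)
From HB Require Import structures.
From mathcomp Require Import all_boot all_order all_algebra.
From mathcomp Require Import boolp classical_sets reals complex.

Set Implicit Arguments.
Unset Strict Implicit.
Unset Printing Implicit Defensive.

Import Order.TTheory GRing.Theory Num.Theory.

Local Open Scope classical_set_scope.
Local Open Scope ring_scope.

(* Polynomials of degree exactly k, all of whose coefficients are positive. *)
Definition pos_poly (R : realType) (k : nat) : set {poly R} :=
  [set f | size f = k.+1 /\ forall i : nat, (i <= k)%N -> 0 < f`_i].

Definition hurwitz (R : realType) (k : nat) : set {poly R} :=
  [set f | pos_poly k f /\
           forall z : R[i], root (map_poly (real_complex R) f) z ->
             complex.Re z < 0].

(* Only meaningful for i >= 2 (the subtractions are truncated). *)
Definition lambda (R : realType) (f : {poly R}) (i : nat) : R :=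
  (f`_(i - 2) * f`_(i + 1)) / (f`_i * f`_(i - 1)).

(* For k <= 2 both classes are the Hurwitz stable polynomials by convention.
   The case k = 0 is a junk value. *)
Definition classW (R : realType) (k : nat) : set {poly R} :=
  if (k <= 2)%N then hurwitz k
  else [set f | pos_poly k f /\
                forall i : nat, (2 <= i <= k - 1)%N -> lambda f i < 1].

Definition classV (R : realType) (k : nat) : set {poly R} :=
  if (k <= 2)%N then hurwitz k
  else [set f | pos_poly k f /\ \sum_(2 <= i < k) lambda f i < 1].

(* With deg f = n and deg g = m, so that size g = m.+1, this is F_j. *)
Definition hadamard_shift (R : realType) (f g : {poly R}) (j : nat) : {poly R} :=
  \poly_(i < size g) (f`_(j + i) * g`_i).

(* The difference of the sizes is n - m when deg f = n and deg g = m. *)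
Definition gen_hadamard (R : realType) (f g : {poly R}) : set {poly R} :=
  [set hadamard_shift f g j | j in [set j : nat | (j <= size f - size g)%N]].

(* Main.v *)
Require Import Defs.
From HB Require Import structures.
From mathcomp Require Import all_boot all_order all_algebra.
From mathcomp Require Import boolp classical_sets reals complex.
From mathcomp Require Import ring lra zify.
Set Implicit Arguments.
Unset Strict Implicit.
Unset Printing Implicit Defensive.

Import Order.TTheory GRing.Theory Num.Theory.
Local Open Scope classical_set_scope.
Local Open Scope ring_scope.

(* Degree at most 2: both classes consist of all polynomials with positive
   coefficients.  Degree m >= 3: lambda_i(F_j) = lambda_(i+j)(f) lambda_i(g),
   where the first factor is < 1 and the second is positive. *)

(** Write f = a + b s + c s^2 and suppose z = x + iy is a root with x >= 0. The imaginary part y (b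
    + 2 c x) of f(z) vanishes and its second factor is positive, so y = 0; the real part is then a +
    b x + c x^2 > 0, a contradiction. Allowing c = 0 covers degree 1. *)
Lemma root_Re_lt0_quadratic (R : realType) (f : {poly R}) (z : R[i]) :
  (size f <= 3)%N -> 0 < f`_0 -> 0 < f`_1 -> 0 <= f`_2 ->
  root (map_poly (real_complex R) f) z -> complex.Re z < 0.
Proof.
move=> sf f0 f1 f2; case: z => x y /rootP.
rewrite (@horner_coef_wide _ 3) ?size_map_poly //.
rewrite !big_ord_recr big_ord0 /= !coef_map /= add0r expr0 mulr1 expr1 expr2.
move=> [] hre him.
rewrite ltNge; apply/negP => x0.
have /eqP : y * (f`_1 + 2 * (f`_2 * x)) = 0 by rewrite -[RHS]him; ring.
have f2x : 0 <= f`_2 * x by rewrite mulr_ge0.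
rewrite mulf_eq0 => /orP[/eqP y0|/eqP]; last by lra.
have f1x : 0 <= f`_1 * x by rewrite mulr_ge0 // ltW.
have f2xx : 0 <= f`_2 * x * x by rewrite mulr_ge0.
move: hre; rewrite y0 => hre.
have : f`_0 + f`_1 * x + f`_2 * x * x = 0 by rewrite -[RHS]hre; ring.
by lra.
Qed.

Lemma pos_poly_hurwitz (R : realType) (k : nat) (f : {poly R}) :
  (0 < k <= 2)%N -> pos_poly k f -> hurwitz k f.
Proof.
move=> /andP[k0 k2] fk; split=> //; case: fk => sf fpos z.
apply: root_Re_lt0_quadratic; rewrite ?sf ?fpos //.
(* For [k = 1] the coefficient of index 2 lies beyond the size and takes the default value 0. *)
have [/fpos/ltW//|k_lt2] := leqP 2 k.
by rewrite nth_default // sf.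
Qed.

Lemma classW_pos (R : realType) (k : nat) (f : {poly R}) :
  classW k f -> pos_poly k f.
Proof. by rewrite /classW; case: ifP => _ []. Qed.

Lemma classV_pos (R : realType) (k : nat) (f : {poly R}) :
  classV k f -> pos_poly k f.
Proof. by rewrite /classV; case: ifP => _ []. Qed.

Lemma lambda_gt0 (R : realType) (k i : nat) (f : {poly R}) :
  pos_poly k f -> (i < k)%N -> 0 < lambda f i.
Proof.
by move=> [_ fpos] ik; rewrite divr_gt0 // mulr_gt0 // fpos //; lia.
Qed.

Lemma pos_poly_hadamard_shift (R : realType) (m n j : nat) (f g : {poly R}) :
  pos_poly n f -> pos_poly m g -> (j + m <= n)%N ->
  pos_poly m (hadamard_shift f g j).
Proof.
move=> [_ fpos] [sg gpos] jmn.
have cpos i : (i <= m)%N -> 0 < f`_(j + i) * g`_i.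
  by move=> im; rewrite mulr_gt0 ?gpos // fpos //; lia.
rewrite /hadamard_shift sg; split=> [|i im].
  (* The degree is exactly [m] because the top coefficient, of index [m], is positive. *)
  by rewrite size_poly_eq //= gt_eqF // cpos.
by rewrite coef_poly ltnS im cpos.
Qed.

Lemma lambda_hadamard_shift (R : realType) (j i : nat) (f g : {poly R}) :
  (2 <= i)%N -> (i.+1 < size g)%N ->
  lambda (hadamard_shift f g j) i = lambda f (j + i) * lambda g i.
Proof.
move=> i2 ig; rewrite /lambda /hadamard_shift !coef_poly.
rewrite !ifT; try lia.
(* Since [2 <= i], truncated subtraction commutes with the shift: [j + (i - 2) = (j + i) - 2]. *)
rewrite !addnBA ?addnA //; last by lia.
by rewrite mulrACA [X in _ / X]mulrACA mulf_div.
Qed.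

Theorem theorem6 (R : realType) (m n : nat)
    (m_gt0 : (0 < m)%N) (n_gt0 : (0 < n)%N) (le_mn : (m <= n)%N)
    (f g : {poly R}) (fW : classW n f) (gV : classV m g) :
  gen_hadamard f g `<=` classV m.
Proof.
have fpos := classW_pos fW; have gpos := classV_pos gV.
have [sf sg] : size f = n.+1 /\ size g = m.+1 by case: fpos; case: gpos.
move=> _ [j /= jle <-]; rewrite sf sg in jle.
have Fpos : pos_poly m (hadamard_shift f g j).
  by apply: pos_poly_hadamard_shift fpos gpos _; lia.
move: gV fW; rewrite /classV /classW; case: ifP => m2.
  by move=> _ _; apply: pos_poly_hurwitz; rewrite ?m_gt0.
(* Here [2 < m <= n], so membership of [f] is also given by the inequalities on [lambda]. *)
rewrite ifF; last by lia.
move=> [_ gsum] [_ flt]; split=> //; apply: le_lt_trans gsum.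
apply: ler_sum_nat => i /andP[i2 im].
rewrite lambda_hadamard_shift ?sg //.
(* From [i < m] and [j <= n - m] follows [2 <= j + i <= n - 1], the range where
   [lambda f (j + i) < 1]. *)
rewrite ler_piMl ?ltW ?(lambda_gt0 gpos) // flt //; lia.
Qed.
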